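(* Let $P=\langle \Sigma \mid R\rangle^+$, $G=\langle\Sigma\mid R\rangle$, $\Omega$, $\Omega_\infty$ and the partial action $G\curvearrowright\Omega$ be as in the context (in particular $P$ is right LCM, the presentation satisfies the standing assumptions, and $P\to G$ is injective). Suppose that $|\Sigma|\ge 2$. Assume that there is a non-empty word $z\in\Sigma^*$ such that $z$ is not a subword of a relator, no relator is a subword of $z$, no non-empty prefix of $z$ is a suffix of a relator, and no non-empty suffix of $z$ is a prefix of a relator. (i) If there exist $a_1,\dots,a_n\in P$ such that $P\setminus\{e\}=\bigcup_{i=1}^n a_iP$, then $\overline{G.\chi}=\Omega_\infty$ for every $\chi\in\Omega_\infty$. (ii) If one cannot write $P\setminus\{e\}=\bigcup_{i=1}^n a_iP$ for some $a_1,\dots,a_n\in P$, then $\overline{G.\chi}=\Omega$ for every $\chi\in\Omega_\infty$. Moreover, in either case there exists $\omega\in\Omega_\infty$ with trivial stabilizer group, $G_\omega=\{e\}$.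
   Context: Presentations. $\Sigma$ is a countable set, $\Sigma^*$ is the free monoid on $\Sigma$ (finite words, $\varepsilon$ the empty word), $R\subseteq\Sigma^*\times\Sigma^*$, and $P=\langle\Sigma\mid R\rangle^+$ is the monoid generated by $\Sigma$ subject to the relations $u=v$ for $(u,v)\in R$. A relator is a word $u$ such that $(u,v)\in R$ or $(v,u)\in R$ for some $v$. ''Subword'' means block of consecutive letters. Standing assumptions on the presentation: for all $(u,v)\in R$ both $u$ and $v$ are non-empty words; no generator is redundant, i.e. for every $\sigma\in\Sigma$ and every $w\in(\Sigma\setminus\{\sigma\})^*$, $\sigma\ne w$ in $P$; and $R$ contains no pair $(u,u)$. It follows that the only invertible element of $P$ is the identity $e$. $P$ is assumed to be right LCM: for $p,q\in P$, either $pP\cap qP=\emptyset$ or $pP\cap qP=rP$ for some $r\in P$. $G=\langle\Sigma\mid R\rangle$ is the group with the same presentation; the canonical homomorphism $P\to G$ is assumed injective, and $P$ is viewed as a submonoid of $G$. Character space. Let $\mathcal J=\{pP: p\in P\}\cup\{\emptyset\}$, a semilattice under intersection. $\Omega$ is the set of surjective multiplicative maps $\chi:\mathcal J\to\{0,1\}$ (i.e. $\chi(S\cap T)=\chi(S)\chi(T)$) with $\chi(\emptyset)=0$, with the topology of pointwise convergence. $P$ is identified with a subset of $\Omega$: $p\in P$ corresponds to $\chi_{pP}$ with $\chi_{pP}(xP)=1$ if and only if $pP\subseteq xP$. $\Omega_\infty:=\Omega\setminus P$. Partial action. For $g\in G$, $U_{g^{-1}}$ is the set of $\chi\in\Omega$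 such that $\chi(qP)=1$ for some $q\in P$ with $g=pq^{-1}$ for some $p\in P$; for such $\chi$, $g.\chi\in\Omega$ is given by $(g.\chi)(xP)=\chi(qyP)$ if $xP\cap pP=pyP$ and $(g.\chi)(xP)=0$ if $xP\cap pP=\emptyset$. $G.\chi=\{g.\chi: g\in G,\ \chi\in U_{g^{-1}}\}$ is the orbit and $G_\chi=\{g\in G:\chi\in U_{g^{-1}},\ g.\chi=\chi\}$ the stabilizer group of $\chi$. Closures are taken in $\Omega$. *)

(* Defs.v *)
From HB Require Import structures.
From mathcomp Require Import all_boot.
From mathcomp Require Import all_classical.
From mathcomp Require Import topology.

Set Implicit Arguments.
Unset Strict Implicit.
Unset Printing Implicit Defensive.

Local Open Scope classical_set_scope.
Local Open Scope group_scope.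
Local Open Scope quotient_scope.

Section PresentedMonoid.
Context {A : choiceType} (R : set (seq A * seq A)).

Inductive word_cong : seq A -> seq A -> Prop :=
| word_cong_refl u : word_cong u u
| word_cong_sym u v : word_cong u v -> word_cong v u
| word_cong_trans u v w : word_cong u v -> word_cong v w -> word_cong u w
| word_cong_step l u v r :
    R (u, v) -> word_cong (l ++ u ++ r) (l ++ v ++ r).

Definition word_congb (u v : seq A) : bool := `[< word_cong u v >].

Lemma word_congb_refl : reflexive word_congb.
Proof. by move=> u; apply/asboolP; exact: word_cong_refl. Qed.

Lemma word_congb_sym : symmetric word_congb.
Proof.
by move=> u v; apply/asboolP/asboolP; exact: word_cong_sym.
Qed.

Lemma word_congb_trans : transitive word_congb.
Proof.
move=> v u w /asboolP uv /asboolP vw; apply/asboolP.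
exact: word_cong_trans uv vw.
Qed.

Canonical word_cong_equiv :=
  EquivRel word_congb word_congb_refl word_congb_sym word_congb_trans.

Definition pres_monoid : Type := {eq_quot word_cong_equiv}.
HB.instance Definition _ := Choice.on pres_monoid.

Definition word_class (w : seq A) : pres_monoid := \pi_({eq_quot word_cong_equiv}) w.

Lemma word_classP u v : word_class u = word_class v <-> word_cong u v.
Proof.
by split=> [/eqmodP/asboolP//|uv]; apply/eqmodP/asboolP.
Qed.

Definition word_repr (x : pres_monoid) : seq A :=
  repr (x : {eq_quot word_cong_equiv}).

Lemma word_reprK : cancel word_repr word_class.
Proof. exact: reprK. Qed.

Lemma word_cong_class w : word_cong (word_repr (word_class w)) w.
Proof. by apply/word_classP; exact: word_reprK. Qed.

Lemma word_cong_ctx l r u v :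
  word_cong u v -> word_cong (l ++ u ++ r) (l ++ v ++ r).
Proof.
elim=> [w|{}u {}v _|{}u {}v w _ IH1 _|l' {}u {}v r' Ruv].
- exact: word_cong_refl.
- exact: word_cong_sym.
- exact: word_cong_trans.
- have := word_cong_step (l ++ l') (r' ++ r) Ruv.
  by rewrite -!catA.
Qed.

Lemma word_cong_cat u u' v v' :
  word_cong u u' -> word_cong v v' -> word_cong (u ++ v) (u' ++ v').
Proof.
move=> /(word_cong_ctx [::] v) uu' /(word_cong_ctx u' [::]) vv'.
by move: uu' vv'; rewrite /= !cats0; exact: word_cong_trans.
Qed.

Definition pres_one : pres_monoid := word_class [::].
Definition pres_mul (x y : pres_monoid) : pres_monoid :=
  word_class (word_repr x ++ word_repr y).

Lemma pres_mulE u v : pres_mul (word_class u) (word_class v) = word_class (u ++ v).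
Proof. by apply/word_classP/word_cong_cat; exact: word_cong_class. Qed.

Lemma pres_mulA : associative pres_mul.
Proof.
move=> x y z; rewrite -(word_reprK x) -(word_reprK y) -(word_reprK z).
by rewrite !pres_mulE catA.
Qed.

Lemma pres_mul1 : left_id pres_one pres_mul.
Proof. by move=> x; rewrite -(word_reprK x) pres_mulE. Qed.

Lemma pres_mulr1 : right_id pres_one pres_mul.
Proof. by move=> x; rewrite -(word_reprK x) pres_mulE cats0. Qed.

HB.instance Definition _ :=
  isMonoid.Build pres_monoid pres_mulA pres_mul1 pres_mulr1.

Lemma word_class_cat u v : word_class (u ++ v) = word_class u * word_class v.
Proof. by rewrite -pres_mulE. Qed.

End PresentedMonoid.

Section PresentedGroup.
Context {A : choiceType} (R : set (seq A * seq A)).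

(* The letter (a, true) stands for the generator a, and (a, false) for its
   formal inverse. *)
Definition pos_word (w : seq A) : seq (A * bool) := [seq (a, true) | a <- w].

Definition group_rels : set (seq (A * bool) * seq (A * bool)) :=
  [set (pos_word uv.1, pos_word uv.2) | uv in R] `|`
  [set ([:: (ab.1, ab.2); (ab.1, ~~ ab.2)], [::]) | ab in [set: A * bool]].

Definition pres_group : Type := pres_monoid group_rels.
HB.instance Definition _ := Monoid.on pres_group.

Definition inv_word (w : seq (A * bool)) : seq (A * bool) :=
  rev [seq (a.1, ~~ a.2) | a <- w].

Lemma inv_wordK : involutive inv_word.
Proof.
move=> w; rewrite /inv_word map_rev revK -map_comp -[RHS]map_id.
by apply: eq_map => -[a b] /=; rewrite negbK.
Qed.

Lemma inv_word_cat u v : inv_word (u ++ v) = inv_word v ++ inv_word u.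
Proof. by rewrite /inv_word map_cat rev_cat. Qed.

Lemma mul_inv_word w : word_cong group_rels (w ++ inv_word w) [::].
Proof.
elim: w => [|[a b] w IH]; first exact: word_cong_refl.
rewrite -cat1s inv_word_cat catA -(catA [:: _]) -catA.
apply: word_cong_trans (_ : word_cong _ ([:: (a, b)] ++ [::] ++ inv_word [:: (a, b)]) _).
  by rewrite -catA (catA w); exact: word_cong_ctx.
by have := @word_cong_step _ group_rels [::] _ _ [::] (or_intror (ex_intro2 _ _ (a, b) I erefl)).
Qed.

Lemma inv_mul_word w : word_cong group_rels (inv_word w ++ w) [::].
Proof. by rewrite -[X in _ ++ X]inv_wordK; exact: mul_inv_word. Qed.

Definition pres_inv (x : pres_group) : pres_group :=
  word_class group_rels (inv_word (word_repr x)).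

Lemma pres_mulVg : left_inverse 1 pres_inv ( *%g).
Proof.
move=> x; rewrite -[X in _ * X](word_reprK x) -word_class_cat.
by apply/word_classP; exact: inv_mul_word.
Qed.

Lemma pres_mulgV : right_inverse 1 pres_inv ( *%g).
Proof.
move=> x; rewrite -[X in X * _](word_reprK x) -word_class_cat.
by apply/word_classP; exact: mul_inv_word.
Qed.

HB.instance Definition _ := hasInv.Build pres_group pres_inv.
HB.instance Definition _ :=
  Monoid_isGroup.Build pres_group pres_mulVg pres_mulgV.

Definition to_group (x : pres_monoid R) : pres_group :=
  word_class group_rels (pos_word (word_repr x)).

Lemma word_cong_pos u v :
  word_cong R u v -> word_cong group_rels (pos_word u) (pos_word v).
Proof.
elim=> [w|{}u {}v _|{}u {}v w _ IH1 _|l {}u {}v r Ruv].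
- exact: word_cong_refl.
- exact: word_cong_sym.
- exact: word_cong_trans.
- rewrite /pos_word !map_cat; apply: word_cong_step.
  by left; exists (u, v).
Qed.

Lemma to_groupE w : to_group (word_class R w) = word_class group_rels (pos_word w).
Proof. by apply/word_classP/word_cong_pos; exact: word_cong_class. Qed.

Lemma to_group_monoid_morphism : monoid_morphism to_group.
Proof.
split=> [|x y]; first by rewrite -[1 in LHS]/(word_class R [::]) to_groupE.
rewrite -(word_reprK x) -(word_reprK y) -word_class_cat !to_groupE.
by rewrite -word_class_cat /pos_word map_cat.
Qed.

HB.instance Definition _ :=
  isUMagmaMorphism.Build (pres_monoid R) pres_group to_group
    to_group_monoid_morphism.

Definition relator (u : seq A) : Prop := exists v, R (u, v) \/ R (v, u).

End PresentedGroup.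

Arguments to_group {A} R x.

Section CharacterSpace.
Context {P : monoidType}.

Definition rideal (p : P) : set P := [set p * x | x in [set: P]].

Definition right_lcm : Prop := forall p q : P,
  rideal p `&` rideal q = set0 \/
  exists r, rideal p `&` rideal q = rideal r.

Definition cideals : set (set P) := range rideal `|` [set set0].

Lemma rideal_cideals p : rideal p \in cideals.
Proof. by apply/mem_set; left; exists p. Qed.

Lemma set0_cideals : set0 \in cideals.
Proof. by apply/mem_set; right. Qed.

Definition pideal (p : P) : cideals := exist _ (rideal p) (rideal_cideals p).
Definition eideal : cideals := exist _ set0 set0_cideals.

(* For a right LCM monoid, [cideals] is closed under intersection, so that the
   third clause covers all pairs (S, T). *)
Definition characters : set {ptws cideals -> bool} := [set chi |
  [/\ set_surj [set: cideals] [set: bool] chi,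
      chi eideal = false
    & forall S T ST : cideals, \val ST = \val S `&` \val T ->
        chi ST = chi S && chi T]].

(* As a [set_type], [Omega] carries the subspace topology of [{ptws _ -> _}],
   the topology of pointwise convergence. *)
Definition Omega : topologicalType := set_type characters.

Definition ev (chi : Omega) (S : cideals) : bool := \val chi S.

Definition principal_fun (p : P) : {ptws cideals -> bool} :=
  fun S => `[< rideal p `<=` \val S >].

Lemma principal_character p : principal_fun p \in characters.
Proof.
have p_p : rideal p p by exists 1; rewrite ?mulg1.
have p0 : principal_fun p eideal = false by apply/asboolP => /(_ _ p_p).
apply/mem_set; split => //.
- move=> [] _ /=; last by exists eideal.
  by exists (pideal p) => //; apply/asboolP.
- move=> S T ST STE; rewrite /principal_fun STE.
  apply/asboolP/andP => [|[/asboolP pS /asboolP pT]].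
    by rewrite subsetI => -[pS pT]; split; apply/asboolP.
  by rewrite subsetI.
Qed.

Definition principal (p : P) : Omega :=
  exist (fun chi => chi \in characters) (principal_fun p) (principal_character p).

Definition Omega_infty : set Omega := ~` range principal.

End CharacterSpace.
Arguments right_lcm P : clear implicits.
Arguments Omega P : clear implicits.
Arguments Omega_infty P : clear implicits.

Section PartialAction.
Context {P : monoidType} {G : groupType} (iota : P -> G).
Implicit Types (g : G) (chi psi : Omega P) (p q x y : P).

(* [shifted p q chi psi] says that psi is given by the formula for (p q^-1).chi. *)
Definition shifted p q chi psi : Prop :=
  (forall x y, rideal x `&` rideal p = rideal (p * y) ->
     ev psi (pideal x) = ev chi (pideal (q * y))) /\
  (forall x, rideal x `&` rideal p = set0 -> ev psi (pideal x) = false).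

(* The graph of the partial action: [acts g chi psi] means that chi belongs to
   the domain of g (denoted U_{g^-1}) and that g.chi = psi.  On that domain
   it is a function, by [acts_fun] and [acts_total] below. *)
Definition acts g chi psi : Prop := exists p q,
  [/\ g = iota p * (iota q)^-1, ev chi (pideal q) & shifted p q chi psi].

Definition act_dom g : set (Omega P) := [set chi | exists p q,
  g = iota p * (iota q)^-1 /\ ev chi (pideal q)].

Definition act_orbit chi : set (Omega P) := [set psi | exists g, acts g chi psi].

Definition act_stabilizer chi : set G := [set g | acts g chi chi].

Hypothesis iotaM : {morph iota : x y / x * y}.
Hypothesis iota_inj : injective iota.
Hypothesis lcmP : right_lcm P.

Lemma iota_mulI p : injective ( *%g p).
Proof. by move=> x y /(congr1 iota); rewrite !iotaM => /mulgI/iota_inj. Qed.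

Lemma mem_rideal p : rideal p p.
Proof. by exists 1; rewrite ?mulg1. Qed.

Lemma rideal_mulP p x : rideal p x <-> rideal x `<=` rideal p.
Proof.
split=> [[y _ <-] _ [z _ <-]|]; last by apply; exact: mem_rideal.
by exists (y * z); rewrite ?mulgA.
Qed.

Lemma rideal_mulS p x y : rideal x `<=` rideal y -> rideal (p * x) `<=` rideal (p * y).
Proof.
by move=> /rideal_mulP[z _ <-]; apply/rideal_mulP; exists z; rewrite ?mulgA.
Qed.

Lemma rideal_mulSI p x y : rideal (p * x) `<=` rideal (p * y) -> rideal x `<=` rideal y.
Proof.
move=> /rideal_mulP[z _]; rewrite -mulgA => /iota_mulI <-.
by apply/rideal_mulP; exists z.
Qed.

Lemma characterP chi :
  [/\ set_surj [set: cideals] [set: bool] (ev chi), ev chi eideal = false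
    & forall S T ST : cideals, \val ST = \val S `&` \val T ->
        ev chi ST = ev chi S && ev chi T].
Proof. exact: (set_mem (valP chi)). Qed.

Lemma cidealP (S : cideals (P := P)) : S = eideal \/ exists x, S = pideal x.
Proof.
case: S => S SJ; have [[x _ xS]|S0] := set_mem SJ.
  by right; exists x; apply: val_inj.
by left; apply: val_inj.
Qed.

Lemma ev_mono chi x y : rideal x `<=` rideal y ->
  ev chi (pideal x) -> ev chi (pideal y).
Proof.
move=> xy; have [_ _ /(_ (pideal x) (pideal y) (pideal x))] := characterP chi.
by move=> -> /=; [case/andP | rewrite setIidl].
Qed.

Lemma ev_lcm chi x y : ev chi (pideal x) -> ev chi (pideal y) ->
  exists2 r, rideal x `&` rideal y = rideal r & ev chi (pideal r).
Proof.
have [_ chi0 chiM] := characterP chi => chix chiy.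
case: (lcmP x y) => [xy0|[r xyr]].
  by have := chiM (pideal x) (pideal y) eideal (esym xy0); rewrite chi0 chix chiy.
by exists r => //; rewrite (chiM (pideal x) (pideal y) (pideal r)) ?chix.
Qed.

Lemma ev_lcm_mul chi q x y :
  ev chi (pideal (q * x)) -> ev chi (pideal (q * y)) ->
  exists r, [/\ rideal x r, rideal y r & ev chi (pideal (q * r))].
Proof.
move=> chix /(ev_lcm chix)[r xyr chir].
have := mem_rideal r; rewrite -{1}xyr => -[[a _]].
rewrite -mulgA => ar [b _]; rewrite -mulgA -ar => /iota_mulI ba.
by exists (x * a); split; [exists a | exists b | rewrite ar].
Qed.

Lemma shiftedP p q chi psi : shifted p q chi psi <->
  forall x, ev psi (pideal x) <->
    exists2 y, rideal x (p * y) & ev chi (pideal (q * y)).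
Proof.
have lcm_p x : rideal x `&` rideal p = set0 \/
    exists y, rideal x `&` rideal p = rideal (p * y).
  case: (lcmP x p) => [|[r xpr]]; [by left|right].
  by have := mem_rideal r; rewrite -{1}xpr => -[_ [y _ yr]]; exists y; rewrite yr.
have get_y x y t : rideal x `&` rideal p = rideal (p * y) ->
    rideal x (p * t) -> ev chi (pideal (q * t)) -> ev chi (pideal (q * y)).
  move=> xpy xpt; apply/ev_mono/rideal_mulS/(@rideal_mulSI p)/rideal_mulP.
  by rewrite -xpy; split=> //; exists t.
have mem_y x y : rideal x `&` rideal p = rideal (p * y) -> rideal x (p * y).
  by move=> xpy; have := mem_rideal (p * y); rewrite -{1}xpy => -[].
split=> [[h1 h0] x|h].
  split=> [psix|[t xpt chit]].
    case: (lcm_p x) => [/h0|[y xpy]]; first by rewrite psix.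
    by exists y; [exact: mem_y | rewrite -(h1 _ _ xpy)].
  case: (lcm_p x) => [xp0|[y xpy]]; last by rewrite (h1 _ _ xpy) (get_y _ _ _ xpy xpt).
  suff : (set0 : set P) (p * t) by [].
  by rewrite -xp0; split=> //; exists t.
split=> x => [y xpy|xp0].
  apply/idP/idP => [/h[t]|chiy]; first exact: get_y.
  by apply/h; exists y => //; exact: mem_y.
apply/negP => /h[t xpt _]; suff : (set0 : set P) (p * t) by [].
by rewrite -xp0; split=> //; exists t.
Qed.

Lemma shifted_mul p q s chi psi : ev chi (pideal (q * s)) ->
  shifted p q chi psi <-> shifted (p * s) (q * s) chi psi.
Proof.
move=> chis; rewrite !shiftedP; split=> h x; rewrite h; split.
- move=> [y xpy chiy]; have [r [[a _ ar] [b _ br] chir]] := ev_lcm_mul chis chiy.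
  exists a; rewrite -mulgA ar //; move: xpy => [c _ cE].
  by exists (c * b) => //; rewrite mulgA cE -mulgA br.
- by move=> [y xpy chiy]; exists (s * y); rewrite mulgA.
- by move=> [y xpy chiy]; exists (s * y); rewrite mulgA.
- move=> [y xpy chiy]; have [r [[a _ ar] [b _ br] chir]] := ev_lcm_mul chis chiy.
  exists a; rewrite -mulgA ar //; move: xpy => [c _ cE].
  by exists (c * b) => //; rewrite mulgA cE -mulgA br.
Qed.

(* The formula for g.chi does not depend on the choice of p and q. *)
Lemma acts_shifted g chi psi p q : acts g chi psi ->
  g = iota p * (iota q)^-1 -> ev chi (pideal q) -> shifted p q chi psi.
Proof.
move=> [p' [q' [-> chiq' h]]] gE chiq.
have [r qqr chir] := ev_lcm chiq chiq'.
have := mem_rideal r; rewrite -{1}qqr => -[[s _ sr] [s' _ s'r]].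
have /iota_inj ps : iota (p * s) = iota (p' * s').
  apply: (mulIg (iota (q * s))^-1); rewrite {2}sr -s'r !iotaM !invgM.
  by rewrite !mulgA !mulgK.
have chis : ev chi (pideal (q * s)) by rewrite sr.
have chis' : ev chi (pideal (q' * s')) by rewrite s'r.
apply/(shifted_mul p psi chis); rewrite ps sr -s'r.
exact/(shifted_mul p' psi chis').
Qed.

Lemma acts_fun g chi psi psi' : acts g chi psi -> acts g chi psi' -> psi = psi'.
Proof.
move=> hpsi [p [q [gE chiq h']]]; have h := acts_shifted hpsi gE chiq.
apply/val_inj/funext => S; change (ev psi S = ev psi' S).
case: (cidealP S) => [->|[x ->]].
  by have [_ -> _] := characterP psi; have [_ -> _] := characterP psi'.
have E := (shiftedP p q chi psi).1 h x; have E' := (shiftedP p q chi psi').1 h' x.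
by apply/idP/idP => [/E/E'|/E'/E].
Qed.

Lemma acts_total g chi : act_dom g chi -> exists psi, acts g chi psi.
Proof.
move=> [p [q [gE chiq]]].
pose f : {ptws cideals -> bool} := fun S : cideals =>
  `[< exists2 y, rideal (p * y) `<=` \val S & ev chi (pideal (q * y)) >].
have f0 : f eideal = false.
  by apply/asboolP => -[y /(_ _ (mem_rideal _))].
have fP : f \in characters.
  apply/mem_set; split => //.
    move=> [] _ /=; last by exists eideal.
    exists (pideal 1) => //; apply/asboolP; exists 1; last by rewrite mulg1.
    by apply/rideal_mulP; exists (p * 1); rewrite ?mul1g.
  move=> S T ST STE; rewrite /f STE; apply/asboolP/andP.
    move=> [y]; rewrite subsetI => -[yS yT] chiy.
    by split; apply/asboolP; exists y.
  move=> [/asboolP[y yS chiy] /asboolP[t tT chit]].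
  have [r [/rideal_mulP ry /rideal_mulP rt chir]] := ev_lcm_mul chiy chit.
  exists r => //; rewrite subsetI; split=> w.
    by move=> /(rideal_mulS (p := p) ry)/yS.
  by move=> /(rideal_mulS (p := p) rt)/tT.
exists (exist (fun h => h \in characters) f fP), p, q; split=> //.
apply/shiftedP => x; split=> [/asboolP[y /rideal_mulP xpy chiy]|[y xpy chiy]].
  by exists y.
by apply/asboolP; exists y => //; apply/rideal_mulP.
Qed.

End PartialAction.

(* Main.v *)
Require Import Defs.
From HB Require Import structures.
From mathcomp Require Import all_boot.
From mathcomp Require Import all_classical.
From mathcomp Require Import topology.
From mathcomp Require Import zify.

(** The word z never interacts with a relator: neither contains the other, and
    they cannot overlap partially.  So a rewriting step applied to l z r takes
    place inside l or inside r, and any word equal to l z r in P is l' z r' with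
    l = l' and r = r' in P ([overlap_free_cong]).  All geometric input about P
    comes from this rigidity, in two forms.

    Blocking.  If s z y lies in qP and Q is a word for q, then Q t = s' z y' as
    words, with s' = s in P.  Either Q is a prefix of s', so that s is in qP, or
    s' is a prefix of Q, which leaves finitely many values of s
    ([overlap_free_blocks]).

    Separation.  If p <> v then pxP and vxP are disjoint for some x
    ([separating_word]): x is a high power of z closed by a marker, and two
    copies of it in one word can only be at the same place.

    Density of orbits.  A basic neighbourhood of psi is given by p with
    psi(pP) = 1 and finitely many q with psi(qP) = 0.  By blocking, once
    infinitely many s in pP lie outside all these qP, some s makes szP disjoint
    from every qP; then (sz).chi is in the neighbourhood, whatever chi is
    ([mem_closure_orbit]).  When psi is not principal, there are infinitely many
    such s because the filter { s | psi(sP) = 1 } has no least ideal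
    ([infty_room]).  When psi is principal, finitely many of them would make
    P minus its identity a finite union of principal right ideals
    ([principal_room]).  If P minus its identity is such a union, principal
    characters are isolated points and no orbit of Omega_infty reaches them
    ([nonidentity_fg_infty_closed], [orbit_infty]).

    Trivial stabilizer.  P is countable, so all pairs (p, q) with p <> q can be
    listed.  A decreasing chain of ideals w_k P is built so that step k settles
    the k-th pair: either w_(k+1)P misses qP, or w_(k+1) lies in qyP where, by
    separation, pyP and qyP are disjoint.  In both cases p q^-1 does not fix the
    character whose filter is generated by the w_k ([trivial_stabilizer]). *)

Set Implicit Arguments.
Unset Strict Implicit.
Unset Printing Implicit Defensive.

Local Open Scope classical_set_scope.
Local Open Scope group_scope.

(** * Words that do not overlap the relators *)

Lemma cat_eq_cat (T : Type) (s1 t1 s2 t2 : seq T) : s1 ++ t1 = s2 ++ t2 ->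
  (exists m, s2 = s1 ++ m /\ t1 = m ++ t2) \/
  (exists m, s1 = s2 ++ m /\ t2 = m ++ t1).
Proof.
elim: s1 s2 => [|x s1 IH] [|y s2] /=.
- by move=> ->; left; exists [::].
- by move=> ->; left; exists (y :: s2).
- by move=> <-; right; exists (x :: s1).
- move=> [<-] /IH[[m [-> ->]]|[m [-> ->]]]; [left|right]; by exists m.
Qed.

Definition overlap_free (A : choiceType) (R : set (seq A * seq A)) (z : seq A) :=
  [/\ forall u, relator R u -> ~~ infix z u,
      forall u, relator R u -> ~~ infix u z,
      forall u v, relator R u -> v <> [::] -> prefix v z -> ~~ suffix v u
    & forall u v, relator R u -> v <> [::] -> suffix v z -> ~~ prefix v u].

Section Words.
Local Open Scope nat_scope.
Context {A : choiceType} {R : set (seq A * seq A)}.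
Implicit Types u v w l r z : seq A.

Lemma rel_relator u v : R (u, v) \/ R (v, u) -> relator R u.
Proof. by move=> uv; exists v. Qed.

Lemma word_cong_relator l r u v : R (u, v) \/ R (v, u) ->
  word_cong R (l ++ u ++ r) (l ++ v ++ r).
Proof.
by move=> [?|?]; [|apply: word_cong_sym]; exact: word_cong_step.
Qed.

(** Induction over [word_cong] in the form used below: a property of words kept
    by each rewriting step, in both directions, is kept by the congruence. *)
Lemma word_cong_closed (C : seq A -> Prop) :
  (forall l u v r, R (u, v) \/ R (v, u) -> C (l ++ u ++ r) -> C (l ++ v ++ r)) ->
  forall u v, word_cong R u v -> C u -> C v.
Proof.
move=> CR u v uv; suff : C u <-> C v by case.
elim: uv => [//|? ? _ ->//|? ? ? _ -> _ ->//|l u' v' r Ruv].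
by split; apply: CR; [left|right].
Qed.

Lemma word_cong_nil u v : (forall w, relator R w -> w <> [::]) ->
  word_cong R u v -> u = [::] -> v = [::].
Proof.
move=> Rne; move: u v; apply: (@word_cong_closed (fun w => w = [::])).
move=> l u v r uv.
case: l => [|b l] //=; case: u uv => [|b u] //= uv.
by case: (Rne _ (rel_relator uv)).
Qed.

(** A rewriting step changes the first letter only by replacing a relator that
    is a prefix by another relator. *)
Lemma word_cong_nohead a u v :
  (forall w, relator R w -> w <> [::]) ->
  (forall w, relator R w -> ~~ prefix [:: a] w) ->
  word_cong R u v -> ~~ prefix [:: a] u -> ~~ prefix [:: a] v.
Proof.
move=> Rne Ra; move: u v.
apply: (@word_cong_closed (fun w => ~~ prefix [:: a] w)) => -[|b l] u v r vu /=;
  last by rewrite !prefix0s.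
move=> _.
have Rv : relator R v by exists u; case: vu; [right|left].
case: v Rv {vu} => [/Rne//|c v /Ra] /=.
by rewrite !prefix0s.
Qed.

Lemma word_cong_letter a u :
  (forall w, relator R w -> w <> [::]) -> ~ relator R [:: a] ->
  word_cong R [:: a] u -> u = [:: a].
Proof.
move=> Rne Ra au; apply: (@word_cong_closed (fun w => w = [:: a]) _ _ _ au) => //.
move=> l {au}w v r uv E.
have Rw := rel_relator uv; have wn := Rne _ Rw.
have [l0 r0] : l = [::] /\ r = [::].
  move/(congr1 size): E; rewrite !size_cat /=; case: (w) wn => //= _ w' _.
  by case: (l); case: (r) => //=; lia.
by move: E; rewrite l0 r0 /= cats0 => wa; case: Ra; rewrite -wa.
Qed.

(** Two occurrences at overlapping places would give one of the four forbidden
    configurations, so u is entirely to the left or to the right of z. *)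
Lemma overlap_free_split z l r l0 u r0 : overlap_free R z -> relator R u ->
  l0 ++ u ++ r0 = l ++ z ++ r ->
  (exists m, l = l0 ++ u ++ m /\ r0 = m ++ z ++ r) \/
  (exists m, l0 = l ++ z ++ m /\ r = m ++ u ++ r0).
Proof.
move=> [z_u u_z pz sz] Ru /cat_eq_cat[[m [-> E]]|[m [-> E]]].
  left; have [[k [-> ->]]|[k [um E']]] := cat_eq_cat E; first by exists k.
  have k0 : k = [::].
    case: (cat_eq_cat E') => [[j [kz _]]|[j [zk _]]].
      by case/negP: (z_u _ Ru); rewrite um kz; exact: infix_infix.
    apply: contrapT => kn.
    move: (pz u k Ru kn); rewrite zk um prefix_prefix suffix_suffix.
    by move=> /(_ isT).
  by move: um E'; rewrite k0 cats0 => -> ->; exists [::]; rewrite cats0.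
right; have [[k [-> ->]]|[k [zm E']]] := cat_eq_cat E; first by exists k.
have k0 : k = [::].
  case: (cat_eq_cat E') => [[j [ku _]]|[j [uk _]]].
    by case/negP: (u_z _ Ru); rewrite zm ku; exact: infix_infix.
  apply: contrapT => kn.
  move: (sz u k Ru kn); rewrite zm uk prefix_prefix suffix_suffix.
  by move=> /(_ isT).
by move: zm E'; rewrite k0 cats0 => -> ->; exists [::]; rewrite cats0.
Qed.

(** Rigidity: since no relator meets the displayed z, every rewriting step acts
    on one side of it only. *)
Lemma overlap_free_cong z l r w : overlap_free R z -> word_cong R (l ++ z ++ r) w ->
  exists l' r', [/\ w = l' ++ z ++ r', word_cong R l l' & word_cong R r r'].
Proof.
move=> zI lw; pose C w := exists l' r',
  [/\ w = l' ++ z ++ r', word_cong R l l' & word_cong R r r'].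
apply: (@word_cong_closed C _ _ _ lw); last first.
  by exists l, r; split=> //; exact: word_cong_refl.
move=> l0 u v r0 uv [l' [r' [E ll' rr']]].
case: (overlap_free_split zI (rel_relator uv) E) => -[m [Em1 Em2]].
  exists (l0 ++ v ++ m), r'; split=> //; first by rewrite Em2 -!catA.
  by apply: word_cong_trans ll' _; rewrite Em1; exact: word_cong_relator.
exists l', (m ++ v ++ r0); split=> //; first by rewrite Em1 -!catA.
by apply: word_cong_trans rr' _; rewrite Em2; exact: word_cong_relator.
Qed.

Definition wpow z n := iter n (cat z) [::].

Lemma wpowSr z n : wpow z n.+1 = wpow z n ++ z.
Proof.
elim: n => [|n IH]; first by rewrite /wpow /= cats0.
by rewrite -[LHS]/(z ++ wpow z n.+1) {1}IH catA.
Qed.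

Lemma size_wpow z n : size (wpow z n) = n * size z.
Proof. by elim: n => //= n IH; rewrite size_cat IH. Qed.

Lemma nth_wpow a z n i : i < n * size z -> nth a (wpow z n) i = nth a z (i %% size z).
Proof.
elim: n i => [|n IH] i; first by [].
rewrite mulSn /= nth_cat => ilt; case: ltnP => iz; first by rewrite modn_small.
rewrite IH; last lia.
by rewrite -[in RHS](subnK iz) modnDr.
Qed.

(** The words between consecutive copies of z are empty, and stay empty because
    all relators are non-empty. *)
Lemma overlap_free_wpow z n l r w : (forall w, relator R w -> w <> [::]) ->
  overlap_free R z -> 0 < n -> word_cong R (l ++ wpow z n ++ r) w ->
  exists l' r', [/\ w = l' ++ wpow z n ++ r', word_cong R l l' & word_cong R r r'].
Proof.
move=> Rne zI; case: n => // n _; elim: n l r w => [|n IH] l r w.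
  by rewrite /wpow /= cats0; exact: overlap_free_cong.
rewrite -[wpow z n.+2]/(z ++ wpow z n.+1) -catA.
move=> /(overlap_free_cong zI)[l' [r' [-> ll' rr']]].
have [l2 [r2 [-> l20 rr2]]] := IH [::] r r' rr'.
exists l', r2; split=> //.
by rewrite (word_cong_nil Rne l20 erefl) /= -!catA.
Qed.

Arguments wpow : simpl never.

(** * Separating two elements of the monoid *)

(** The powers of z after v and after p' sit in the same word.  Their offset is at
    most N |z|: if v is the longer prefix, because v is short; if p' is, because
    p' would otherwise contain z^N, hence so would p by rigidity, and p is too
    short.  The two hypotheses on m exclude the remaining non-zero offsets. *)
Lemma overlap_free_pow_aligned z N p v p' r r' :
  (forall w, relator R w -> w <> [::]) -> overlap_free R z -> z <> [::] ->
  size p < N -> size v < N -> word_cong R p p' ->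
  (forall m, m <> [::] -> size m <= N * size z ->
     m ++ wpow z N.+1 ++ r <> wpow z N.+1 ++ r') ->
  (forall m, m <> [::] -> size m <= N * size z ->
     m ++ wpow z N.+1 ++ r' <> wpow z N.+1 ++ r) ->
  v ++ wpow z N.+1 ++ r = p' ++ wpow z N.+1 ++ r' -> p' = v.
Proof.
move=> Rne zI z0 pN vN pp' noshift noshift' E.
have sz : 0 < size z by case: (z) z0.
have NzN : N <= N * size z by rewrite leq_pmulr.
case: (cat_eq_cat E) => -[m [Em E']].
  case: (pselect (m = [::])) => [->|mn] in Em *; first by rewrite Em cats0.
  have [mN|mN] := leqP (size m) (N * size z).
    by case: (noshift' m mn mN).
  have [k mk] : exists k, m = wpow z N ++ k.
    move: E'; rewrite wpowSr -catA => /cat_eq_cat[[k [-> _]]|[k [Ek _]]].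
      by exists k.
    by move: mN; rewrite -size_wpow Ek size_cat; lia.
  have := word_cong_sym pp'; rewrite Em mk.
  move=> /(overlap_free_wpow Rne zI (leq_ltn_trans (leq0n _) pN))[l1 [r1 [pE _ _]]].
  by move: pN; rewrite pE !size_cat size_wpow; lia.
case: (pselect (m = [::])) => [->|mn] in Em *; first by rewrite Em cats0.
case: (noshift m mn _ (esym E')).
by move: vN; rewrite Em size_cat; lia.
Qed.

(** When z = a...a, the first letter of r' differs from a but would fall inside
    the shifted power of z. *)
Lemma const_pow_noshift a z N m r r' :
  (forall i, i < size z -> nth a z i = a) ->
  r' <> [::] -> ~~ prefix [:: a] r' -> m <> [::] -> size m <= N * size z ->
  m ++ wpow z N.+1 ++ r <> wpow z N.+1 ++ r'.
Proof.
move=> za rn ra mn mN /(congr1 (fun w => nth a w (N.+1 * size z))) /=.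
rewrite nth_cat [RHS]nth_cat size_wpow ltnn subnn.
have [?|_] := ltnP; first lia.
have m0 : 0 < size m by case: (m) mn.
rewrite nth_cat size_wpow; have -> : N.+1 * size z - size m < N.+1 * size z by lia.
rewrite nth_wpow ?za ?ltn_mod; try lia.
by case: (r') rn ra => //= b w _ + ab; rewrite prefix0s andbT ab eqxx.
Qed.

(** Let d be the offset [size m] and a the first letter of z.  The letters of z
    are found to be a one after the other: below position d because the shifted
    power continues the period through a z, which forces z_(i+1) = z_i; from
    position d on because the two powers overlap, which forces
    z_i = z_(i-d). *)
Lemma pow_letter_shift a z N m r r' : nth a z 0 = a ->
  m <> [::] -> size m <= N * size z ->
  m ++ wpow z N.+1 ++ r = wpow z N.+1 ++ a :: z ++ r' ->
  forall i, i < size z -> nth a z i = a.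
Proof.
move=> z0 mn mN E; elim/ltn_ind=> i IH iz.
have d0 : 0 < size m by case: (m) mn.
(* T is the common word; T1 and T3 read it on the right-hand side, T2 on the
   left-hand side. *)
pose T j := nth a (wpow z N.+1 ++ a :: z ++ r') j.
have T1 j : j < N.+1 * size z -> T j = nth a z (j %% size z).
  by move=> jN; rewrite /T nth_cat size_wpow jN nth_wpow.
have T2 j : size m <= j -> j < size m + N.+1 * size z ->
    T j = nth a z ((j - size m) %% size z).
  move=> mj jN; rewrite /T -E nth_cat ltnNge mj /= nth_cat size_wpow.
  have jN' : j - size m < N.+1 * size z by lia.
  by rewrite jN' nth_wpow.
have T3 j : j < size z -> T (N.+1 * size z + j.+1) = nth a z j.
  move=> jz; rewrite /T nth_cat size_wpow ltnNge leq_addr /= addKn /=.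
  by rewrite nth_cat jz.
case: i IH iz => [//|i] IH iz.
have [im|mi] := ltnP i.+1 (size m).
  transitivity (T (N.+1 * size z + i.+1)); last by rewrite T3 ?IH //; lia.
  have -> : T (N.+1 * size z + i.+1) = T (N * size z + i.+1).
    rewrite !T2; try lia.
    have -> : N.+1 * size z + i.+1 - size m = N * size z + i.+1 - size m + size z
      by lia.
    by rewrite modnDr.
  by rewrite T1 ?modnMDl ?modn_small //; lia.
transitivity (T i.+1); first by rewrite T1 ?modn_small //; lia.
by rewrite T2 ?modn_small ?IH //; lia.
Qed.

(** The marker after the power of z must survive rewriting.  If z = a...a, no
    relator starts with a, so a word that starts with b <> a is never rewritten
    into one that starts with a.  Otherwise the marker is a z, with a the
    first letter of z: the letter a is a subword of z, hence not a relator, and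
    it cannot be rewritten at all. *)
Lemma separating_word z (s t : A) (p v : seq A) :
  (forall w, relator R w -> w <> [::]) -> overlap_free R z -> z <> [::] -> s <> t ->
  exists x, forall y y', word_cong R (p ++ x ++ y) (v ++ x ++ y') ->
    word_cong R p v.
Proof.
move=> Rne zI zn st.
have [N pN vN] : exists2 N, size p < N & size v < N.
  by exists (size p + size v).+1; rewrite ltnS ?leq_addl ?leq_addr.
have [zu uz pz sz] := zI.
have [a [z' zE]] : exists a z', z = a :: z'.
  by case: (z) zn => // a z' _; exists a, z'.
(* za says that z is a power of the single letter a. *)
case: (pselect (forall i, i < size z -> nth a z i = a)) => [za|nza].
  have [b ba] : exists b, b <> a.
    case: (pselect (s = a)) => [sa|]; last by exists s.
    by exists t => ta; apply: st; rewrite sa.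
  have Ra w : relator R w -> ~~ prefix [:: a] w.
    move=> Rw; apply: (sz _ _ Rw) => //.
    have la : last a z' = a.
      by rewrite (last_nth a) -zE; apply: za; rewrite zE.
    by rewrite zE (lastI a z') la -cats1 suffix_suffix.
  exists (wpow z N.+1 ++ [:: b]) => y y'; rewrite -!(catA (wpow _ _)).
  have bw w : ~~ prefix [:: a] ([:: b] ++ w).
    by rewrite /= prefix0s andbT; apply/eqP => /esym.
  move=> /(overlap_free_wpow Rne zI (ltn0Sn N))[p' [r' [E pp' br']]].
  suff <- : p' = v by [].
  apply: (@overlap_free_pow_aligned z N p v p' ([:: b] ++ y') r') => //.
    move=> m mn mN; apply: (const_pow_noshift za) => // [r0|].
      by have := word_cong_nil Rne (word_cong_sym br') r0.
    exact: (word_cong_nohead Rne Ra br' (bw _)).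
  by move=> m mn mN; apply: (const_pow_noshift za).
have xE y : (wpow z N.+1 ++ [:: a] ++ z) ++ y = wpow z N.+1 ++ [:: a] ++ z ++ y.
  by rewrite -catA.
exists (wpow z N.+1 ++ [:: a] ++ z) => y y'; rewrite !xE.
move=> /(overlap_free_wpow Rne zI (ltn0Sn N))[p' [r' [E pp' ar']]].
have [l [r2 [r'E al _]]] := overlap_free_cong zI ar'.
have la : l = [:: a].
  apply: word_cong_letter al => // Ra; move: (uz _ Ra).
  by rewrite zE -cat1s prefix_infix ?prefix_prefix.
suff <- : p' = v by [].
have z0 : nth a z 0 = a by rewrite zE.
apply: (@overlap_free_pow_aligned z N p v p' ([:: a] ++ z ++ y') r') => //.
  move=> m mn mN; rewrite r'E la => /(pow_letter_shift z0 mn mN).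
  exact: nza.
by move=> m mn mN /(pow_letter_shift z0 mn mN); exact: nza.
Qed.

End Words.

(** * Characters as filters of principal ideals *)

Section CharacterTopology.
Context {P : monoidType}.
Implicit Types (psi chi : Omega P) (S : cideals (P := P)).
Implicit Types (p q r s t x y : P).

(** The sets of functions that agree with psi on a finite list form a filter
    base; it converges to psi coordinatewise, hence it is finer than the
    neighbourhoods of psi. *)
Lemma nbhs_characterP psi (U : set (Omega P)) : nbhs psi U ->
  exists L : seq (cideals (P := P)),
    forall chi, {in L, ev chi =1 ev psi} -> U chi.
Proof.
pose F : set_system {ptws (cideals (P := P)) -> bool} :=
  [set V | exists L : seq (cideals (P := P)),
     forall f, {in L, f =1 \val psi} -> V f].
have FF : Filter F.
  split; first by exists [::].
    move=> V W [L LV] [M MW]; exists (L ++ M) => f fLM.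
    split; [apply: LV | apply: MW] => S SL; apply: fLM;
      by rewrite mem_cat SL ?orbT.
  by move=> V W VW [L LV]; exists L => f /LV /VW.
have Fpsi : F --> (\val psi : {ptws _ -> _}).
  apply/cvg_sup => S V [B [[C Cop <-] CS sCV]]; exists [:: S] => f fS.
  by apply: sCV; rewrite /= /proj fS ?mem_head.
move=> [_ [[B Bop <-] Bpsi sBU]].
have [L LB] : F B by apply: Fpsi; exact: open_nbhs_nbhs.
by exists L => chi chiL; apply: sBU; apply: LB.
Qed.

Lemma nbhs_ev psi S : \forall chi \near psi, ev chi S = ev psi S.
Proof.
have evc : continuous (fun chi : Omega P => ev chi S).
  move=> chi.
  apply: (@cvg_comp _ _ _ set_val (fun f : {ptws cideals -> bool} => f S)).
    exact: initial_continuous.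
  exact: (@proj_continuous _ (fun=> bool) S).
exact: (evc psi [set ev psi S] (discrete_set1 _)).
Qed.

Lemma character_eq psi chi :
  (forall x, ev psi (pideal x) <-> ev chi (pideal x)) -> psi = chi.
Proof.
move=> E; apply/val_inj/funext => S; change (ev psi S = ev chi S).
case: (cidealP S) => [->|[x ->]].
  by have [_ -> _] := characterP psi; have [_ -> _] := characterP chi.
by apply/idP/idP => /E.
Qed.

Lemma ev_principal p x : ev (principal p) (pideal x) <-> rideal x p.
Proof. by rewrite rideal_mulP; split => [/asboolP|?]; [|apply/asboolP]. Qed.

Lemma ev_one chi : ev chi (pideal 1).
Proof.
have [surj chi0 _] := characterP chi.
have [S _ Strue] := surj true I.
case: (cidealP S) Strue => [->|[x ->]] chix; first by rewrite chi0 in chix.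
apply: (@ev_mono _ chi x 1); last by rewrite chix.
by apply/rideal_mulP; exists x; rewrite ?mul1g.
Qed.

Lemma nonprincipal_ev chi p : Omega_infty P chi -> ev chi (pideal p) ->
  exists2 s, ev chi (pideal s) & ~ rideal s p.
Proof.
move=> chioo chip; apply: contrapT => H; apply: chioo; exists p => //.
apply: character_eq => x; rewrite ev_principal; split=> [|chix].
  by move=> /rideal_mulP; move/ev_mono; apply.
by apply: contrapT => nx; apply: H; exists x.
Qed.

Hypothesis lcmP : right_lcm P.

(** A decreasing sequence of principal ideals generates a filter; meets are
    handled at the larger of two indices. *)
Lemma filter_character (w : nat -> P) : (forall k, rideal (w k) (w k.+1)) ->
  exists chi, forall x, ev chi (pideal x) <-> exists k, rideal x (w k).
Proof.
move=> wS; have wmono j k : j <= k -> rideal (w j) (w k).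
  move=> /subnK <-; elim: (k - j)%N => [|n IH]; first exact: mem_rideal.
  by have [IH' _] := rideal_mulP (w j) (w (n + j)); apply: (IH' IH); exact: wS.
pose f : {ptws cideals -> bool} := fun S : cideals (P := P) =>
  `[< exists k, (\val S) (w k) >].
have fP : f \in characters.
  apply/mem_set; split.
  - move=> [] _ /=; [exists (pideal 1) | exists eideal] => //.
      by apply/asboolP; exists 0, (w 0); rewrite ?mul1g.
    by apply/asboolP => -[].
  - by apply/asboolP => -[].
  - move=> S T ST STE; rewrite /f STE; apply/asboolP/andP.
      by move=> [k [Sk Tk]]; split; apply/asboolP; exists k.
    have up (S' : cideals (P := P)) j k : j <= k ->
        (\val S') (w j) -> (\val S') (w k).
      case: (cidealP S') => [->//|[x ->]] /wmono jk /=.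
      by move=> /rideal_mulP; apply.
    move=> [/asboolP[j Sj] /asboolP[k Tk]]; exists (maxn j k).
    by split; [apply: up Sj; exact: leq_maxl | apply: up Tk; exact: leq_maxr].
exists (exist (fun h => h \in characters) f fP) => x.
by split=> [/asboolP|?]; [|apply/asboolP].
Qed.

(** Since chi is not principal, each element f of its filter can be left behind:
    some s in the filter has f outside sP, and this persists for smaller
    ideals. *)
Lemma nonprincipal_avoid chi p (F : seq P) : Omega_infty P chi ->
  ev chi (pideal p) ->
  exists s, [/\ ev chi (pideal s), rideal p s & s \notin F].
Proof.
move=> chioo chip; suff [s [chis ps Fs]] : exists s,
    [/\ ev chi (pideal s), rideal p s &
        {in F, forall f, ev chi (pideal f) -> ~ rideal s f}].
  by exists s; split=> //; apply/negP => /Fs/(_ chis); apply; exact: mem_rideal.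
elim: F => [|f F [s [chis ps Fs]]]; first by exists p; split=> //; exact: mem_rideal.
case: (pselect (ev chi (pideal f))) => [chif|nf]; last first.
  by exists s; split=> // g; rewrite inE => /predU1P[->//|/Fs].
have [t chit tf] := nonprincipal_ev chioo chif.
have [r srt chir] := ev_lcm lcmP chis chit.
have := mem_rideal r; rewrite -{1}srt => -[sr tr].
exists r; split=> //; first exact: (rideal_mulP p s).1 ps r sr.
move=> g; rewrite inE => /predU1P[->|gF] chig; first by move=> /((rideal_mulP t r).1 tr).
by move=> /((rideal_mulP s r).1 sr); exact: Fs.
Qed.

End CharacterTopology.

(** * Orbits and their closures *)

Section Orbits.
Context {P : monoidType} {G : groupType} (iota : P -> G).
Hypothesis iotaM : {morph iota : x y / x * y}.
Hypothesis iota_inj : injective iota.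
Hypothesis lcmP : right_lcm P.
Implicit Types (psi chi : Omega P) (p q r s t x y : P).

Lemma morph_mulg_one : iota 1 = 1.
Proof. by apply: (@mulgI _ (iota 1)); rewrite -iotaM !mulg1. Qed.

(** Right lcms merge the finitely many ideals on which psi is 1 into one. *)
Lemma nbhs_character_basis psi (U : set (Omega P)) : nbhs psi U ->
  exists p (Q : seq P), [/\ ev psi (pideal p),
    {in Q, forall q, ~ ev psi (pideal q)}
  & forall chi, ev chi (pideal p) ->
      {in Q, forall q, ~ ev chi (pideal q)} -> U chi].
Proof.
move=> /nbhs_characterP[L LU].
suff [p [Q [psip psiQ pQL]]] : exists p (Q : seq P), [/\ ev psi (pideal p),
    {in Q, forall q, ~ ev psi (pideal q)}
  & forall chi, ev chi (pideal p) ->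
      {in Q, forall q, ~ ev chi (pideal q)} -> {in L, ev chi =1 ev psi}].
  by exists p, Q; split=> // chi chip chiQ; apply: LU; exact: pQL.
elim: L {LU} => [|S L [p [Q [psip psiQ pQL]]]].
  by exists 1, [::]; split=> //; exact: ev_one.
case: (cidealP S) => [->|[x ->]].
  exists p, Q; split=> // chi chip chiQ T; rewrite inE => /predU1P[->|TL].
    by have [_ -> _] := characterP psi; have [_ -> _] := characterP chi.
  exact: pQL.
case: (boolP (ev psi (pideal x))) => psix.
  have [r pxr psir] := ev_lcm lcmP psip psix.
  have [rp rx] : rideal r `<=` rideal p /\ rideal r `<=` rideal x.
    by rewrite -pxr; split; [exact: subIsetl | exact: subIsetr].
  exists r, Q; split=> // chi chir chiQ T; rewrite inE => /predU1P[->|TL].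
    by rewrite psix; exact: ev_mono rx chir.
  exact: (pQL _ (ev_mono rp chir)).
exists p, (x :: Q); split=> //.
  by move=> q; rewrite inE => /predU1P[->|/psiQ//]; exact/negP.
move=> chi chip chiQ T; rewrite inE => /predU1P[->|TL].
  by rewrite (negbTE psix); apply/negbTE/negP/chiQ/mem_head.
by apply: pQL => // q qQ; apply: chiQ; rewrite inE qQ orbT.
Qed.

(** An element w of the monoid acts on every character, by translation of the
    filter. *)
Lemma orbit_mul w chi : exists2 psi, act_orbit iota chi psi &
  forall x, ev psi (pideal x) <->
    exists2 y, rideal x (w * y) & ev chi (pideal y).
Proof.
have wE : iota w = iota w * (iota 1)^-1 by rewrite morph_mulg_one invg1 mulg1.
have [|psi wpsi] := acts_total iotaM iota_inj lcmP (g := iota w) (chi := chi).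
  by exists w, 1; split=> //; exact: ev_one.
exists psi; first by exists (iota w).
have /(shiftedP iotaM iota_inj lcmP) h :=
  acts_shifted iotaM iota_inj lcmP wpsi wE (ev_one chi).
move=> x; rewrite h; split=> -[y xwy chiy]; exists y => //.
  by rewrite mul1g in chiy.
by rewrite mul1g.
Qed.

(** The action is invertible, and p q^-1 carries the principal character of qt to
    that of pt. *)
Lemma orbit_infty chi : Omega_infty P chi ->
  act_orbit iota chi `<=` Omega_infty P.
Proof.
move=> chioo psi [g [p [q [_ chiq /(shiftedP iotaM iota_inj lcmP) h]]]] [r _ rE].
rewrite -{psi}rE in h; apply: chioo.
have [t _ ptr] : rideal p r.
  by apply/ev_principal/h; exists 1; [exists 1 | rewrite mulg1].
exists (q * t) => //; apply: character_eq => x; rewrite ev_principal; split.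
  move=> xqt; have /h[y [c _ pcy] chiy] : ev (principal r) (pideal (p * t)).
    by apply/ev_principal; rewrite ptr; exact: mem_rideal.
  apply: (@ev_mono _ chi (q * t)); first exact/rideal_mulP.
  apply: ev_mono chiy; apply/rideal_mulP; exists c => //.
  rewrite -mulgA; congr (_ * _).
  by apply: (iota_mulI iotaM iota_inj (p := p)); rewrite mulgA.
move=> chix; have [u qxu chiu] := ev_lcm lcmP chiq chix.
have := mem_rideal u; rewrite -{1}qxu => -[[y _ yu] xu].
have [c _ ycr] : rideal (p * y) r.
  by apply/ev_principal/h; exists y; [exact: mem_rideal | rewrite yu].
have -> : q * t = u * c.
  rewrite -yu -mulgA; congr (_ * _).
  by apply: (iota_mulI iotaM iota_inj (p := p)); rewrite ptr mulgA.
by apply: ((rideal_mulP x u).1 xu); exists c.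
Qed.

(** If sz is multiplied on the right, it enters qP only when s is already in qP
    or is one of finitely many exceptions; so (sz).chi lies in the neighbourhood
    of psi given by p and Q as soon as s avoids Q and the exceptions. *)
Lemma mem_closure_orbit z psi chi :
  (forall q, exists F : seq P, forall s y, rideal q (s * z * y) ->
     rideal q s \/ s \in F) ->
  (forall p (Q F : seq P), ev psi (pideal p) ->
     {in Q, forall q, ~ ev psi (pideal q)} ->
     exists s, [/\ rideal p s, s \notin F & {in Q, forall q, ~ rideal q s}]) ->
  closure (act_orbit iota chi) psi.
Proof.
move=> zF room U /nbhs_character_basis[p [Q [psip psiQ pQU]]].
have [F FQ] : exists F : seq P, {in Q, forall q s y, rideal q (s * z * y) ->
    rideal q s \/ s \in F}.
  elim: Q {psiQ pQU} => [|q Q [F FQ]]; first by exists [::].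
  have [F' Fq] := zF q; exists (F' ++ F) => q'; rewrite inE => /predU1P[->|q'Q] s y.
    by move=> /Fq[|sF]; [left | right; rewrite mem_cat sF].
  by move=> /(FQ _ q'Q)[|sF]; [left | right; rewrite mem_cat sF orbT].
have [s [ps sF Qs]] := room p Q F psip psiQ.
have [phi orb phiE] := orbit_mul (s * z) chi.
exists phi; split=> //; apply: pQU => [|q qQ /phiE[y qszy _]].
  apply/phiE; exists 1; last exact: ev_one.
  by rewrite mulg1; case: ps => c _ <-; exists (c * z); rewrite ?mulgA.
case: (FQ _ qQ _ _ qszy) => [|sF']; first exact: Qs.
by rewrite sF' in sF.
Qed.

Lemma infty_room psi p (Q F : seq P) : Omega_infty P psi ->
  ev psi (pideal p) -> {in Q, forall q, ~ ev psi (pideal q)} ->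
  exists s, [/\ rideal p s, s \notin F & {in Q, forall q, ~ rideal q s}].
Proof.
move=> psioo psip psiQ; have [s [psis ps sF]] := nonprincipal_avoid lcmP F psioo psip.
exists s; split=> // q qQ qs; apply: (psiQ q qQ).
by apply: ev_mono psis; apply/rideal_mulP.
Qed.

Definition nonidentity_fg := exists (n : nat) (a : 'I_n -> P),
  ~` [set 1] = \bigcup_(i in [set: 'I_n]) rideal (a i).

Hypothesis unit1 : forall x y, x * y = 1 -> x = 1.

Lemma nonidentity_fgI (L : seq P) : {in L, forall a, a <> 1} ->
  (forall t, t <> 1 -> exists2 a, a \in L & rideal a t) -> nonidentity_fg.
Proof.
move=> L1 Lt; exists (size L), (fun i => tnth (in_tuple L) i).
apply/seteqP; split=> [t /Lt[a aL at_]|t [i _ [c _ act]] t1].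
  have [i ia] : exists i, a = tnth (in_tuple L) i by apply/tnthP.
  by exists i => //; rewrite -ia.
by case: (L1 _ (mem_tnth i (in_tuple L))); apply: (unit1 (y := c)); rewrite act.
Qed.

(** By left cancellation, {t | pt in qP} is empty or a principal right ideal aP,
    with a <> 1 when p is not in qP.  If every t <> 1 were in one of these sets,
    they would cover P minus its identity. *)
Lemma not_fg_avoid p (Q : seq P) : ~ nonidentity_fg ->
  {in Q, forall q, ~ rideal q p} ->
  exists2 t, t <> 1 & {in Q, forall q, ~ rideal q (p * t)}.
Proof.
move=> ncof Qp; apply: contrapT => H; apply: ncof.
have [L L1 LQ] : exists2 L : seq P, {in L, forall a, a <> 1} &
    {in Q, forall q t, rideal q (p * t) -> exists2 a, a \in L & rideal a t}.
  elim: Q Qp {H} => [|q Q IH] Qp; first by exists [::].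
  have [|L L1 LQ] := IH.
    by move=> q' q'Q; apply: Qp; rewrite inE q'Q orbT.
  case: (lcmP p q) => [pq0|[r pqr]].
    exists L => // q'; rewrite inE => /predU1P[->|/LQ//] t qpt.
    suff : (set0 : set P) (p * t) by [].
    by rewrite -pq0; split=> //; exists t.
  have := mem_rideal r; rewrite -{1}pqr => -[[a _ par] qr].
  exists (a :: L) => [b|q']; rewrite inE.
    move=> /predU1P[->|/L1//] a1; apply: (Qp q (mem_head _ _)).
    by rewrite -[p]mulg1 -a1 par.
  move=> /predU1P[->|q'Q] t qpt; last first.
    by have [b bL bt] := LQ _ q'Q _ qpt; exists b; rewrite ?inE ?bL ?orbT.
  exists a; first exact: mem_head.
  have [c _ rc] : rideal r (p * t) by rewrite -pqr; split=> //; exists t.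
  exists c => //; apply: (iota_mulI iotaM iota_inj (p := p)).
  by rewrite mulgA par.
apply: (@nonidentity_fgI L) => // t t1; apply: contrapT => nt; apply: H.
by exists t => // q qQ qpt; apply: nt; exact: LQ qpt.
Qed.

(** The elements f of F are excluded by asking that s avoid fP as well.  This is
    possible except when p0 is in fP; but f = p0 t and p0 in fP force t = 1. *)
Lemma principal_room p0 p (Q F : seq P) : ~ nonidentity_fg ->
  ev (principal p0) (pideal p) -> {in Q, forall q, ~ ev (principal p0) (pideal q)} ->
  exists s, [/\ rideal p s, s \notin F & {in Q, forall q, ~ rideal q s}].
Proof.
move=> ncof /ev_principal pp0 Qp0.
pose F' := [seq f <- F | ~~ `[< rideal f p0 >]].
have [|t t1 tQ] := @not_fg_avoid p0 (Q ++ F') ncof.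
  move=> q; rewrite mem_cat => /orP[/Qp0|]; first by rewrite ev_principal.
  by rewrite mem_filter => /andP[/asboolP].
exists (p0 * t); split.
- by case: pp0 => c _ <-; exists (c * t); rewrite ?mulgA.
- apply/negP => tF; case: (pselect (rideal (p0 * t) p0)) => [[c _ E]|nt].
    apply/t1/(unit1 (y := c))/(iota_mulI iotaM iota_inj (p := p0)).
    by rewrite mulgA mulg1.
  apply: (tQ (p0 * t)); last exact: mem_rideal.
  by rewrite mem_cat mem_filter tF andbT; apply/orP; right; apply/asboolP.
- by move=> q qQ; apply: tQ; rewrite mem_cat qQ.
Qed.

(** The principal character of p is isolated: it is the only character that is 1
    at pP and 0 at all p a_i P. *)
Lemma nonidentity_fg_infty_closed : nonidentity_fg ->
  closure (Omega_infty P) `<=` Omega_infty P.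
Proof.
move=> [n [a aE]] psi psicl [p _ pE]; rewrite -{psi}pE in psicl.
pose U : set (Omega P) := [set chi | ev chi (pideal p) /\
  forall i : 'I_n, ~ ev chi (pideal (p * a i))].
have a1 i : a i <> 1.
  have : (\bigcup_(i in [set: 'I_n]) rideal (a i)) (a i).
    by exists i => //; exact: mem_rideal.
  by rewrite -aE.
have nU : nbhs (principal p) U.
  have pS S := nbhs_ev (principal p) S.
  have pU : \forall chi \near principal p, forall i : 'I_n,
      ev chi (pideal (p * a i)) = ev (principal p) (pideal (p * a i)).
    exact: filter_forall (fun i => pS (pideal (p * a i))).
  apply: filterS2 (pS (pideal p)) pU => chi chip chia; split.
    by rewrite chip; apply/ev_principal/mem_rideal.
  move=> i; rewrite chia => /ev_principal[c _ pac].
  apply: (a1 i); apply: (unit1 (y := c)).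
  by apply: (iota_mulI iotaM iota_inj (p := p)); rewrite mulgA mulg1.
have [chi [chioo [chip chia]]] := psicl U nU.
have [s chis sp] := nonprincipal_ev chioo chip.
have [r psr chir] := ev_lcm lcmP chip chis.
have := mem_rideal r; rewrite -{1}psr => -[[t _ ptr] sr].
have : (~` [set 1]) t.
  by move=> t1; apply: sp; rewrite -[p]mulg1 -t1 ptr.
rewrite aE => -[i _ [c _ ct]]; apply: (chia i).
by apply: ev_mono chir; apply/rideal_mulP; exists c; rewrite // -mulgA ct.
Qed.

End Orbits.

(** * A character with trivial stabilizer *)

(** If p q^-1 fixes omega and omega(qyP) = 1, then omega(pyP) = 1, so pyP and
    qyP meet.  The diagonal chain w_k prevents this for every pair p <> q.  Each
    step also multiplies by a <> 1, so that the chain has no least ideal and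
    omega is not principal. *)
Lemma trivial_stabilizer (P : monoidType) (G : groupType) (iota : P -> G)
    (e : nat -> P * P) (a : P) :
  {morph iota : x y / x * y} -> injective iota -> right_lcm P ->
  (forall x y : P, x * y = 1 -> x = 1) -> a <> 1 ->
  (forall pq, exists k, e k = pq) ->
  (forall p q : P, p <> q -> exists x, forall y y', p * x * y <> q * x * y') ->
  exists2 omega : Omega P, Omega_infty P omega &
    act_stabilizer iota omega = [set 1].
Proof.
move=> iotaM iota_inj lcmP unit1 a1 e_surj sep.
(* What step k, starting from w = kw.2, must achieve for the k-th pair. *)
pose decided (kw : nat * P) w' := exists2 c, w' = kw.2 * c &
  c <> 1 /\ let: (p, q) := e kw.1 in p <> q ->
    rideal w' `&` rideal q = set0 \/
    exists2 y, rideal (q * y) w' & rideal (p * y) `&` rideal (q * y) = set0.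
have /choice[f fP] : forall kw, exists w', decided kw w'.
  move=> [k w]; rewrite /decided /=; case: (e k) => p q.
  have ca c : c * a <> 1 by move=> /[dup] /unit1 ->; rewrite mul1g.
  case: (pselect (p = q)) => [pq|npq]; first by exists (w * a), a; split.
  case: (pselect (exists s t, w * s = q * t)) => [[s [t wsqt]]|nwq]; last first.
    exists (w * a), a; split=> // _; left; rewrite -subset0 => _ [[s _ <-] [t _ wq]].
    by apply: nwq; exists (a * s), t; rewrite mulgA.
  (* Now w s = q t: the pair (pt, qt) is separated below w. *)
  have [x xP] : exists x, forall y y', p * t * x * y <> q * t * x * y'.
    apply: sep => ptqt; apply: npq; apply: iota_inj.
    by apply: (@mulIg _ (iota t)); rewrite -!iotaM ptqt.
  exists (w * (s * x * a)), (s * x * a); split=> // _; right; exists (t * x).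
    by exists a; rewrite // !mulgA wsqt.
  rewrite -subset0 => _ [[y _ <-] [y' _ /esym]]; rewrite !mulgA; exact: xP.
pose w := fix w k := if k is k'.+1 then f (k', w k') else 1.
have wS k : rideal (w k) (w k.+1) by have [c cE _] := fP (k, w k); exists c.
have [omega omegaE] := filter_character wS.
have omega_meet x y : ev omega (pideal x) -> ev omega (pideal y) ->
    rideal x `&` rideal y <> set0.
  move=> ox /(ev_lcm lcmP ox)[r -> _] r0.
  by suff : (set0 : set P) r by []; rewrite -r0; exact: mem_rideal.
exists omega.
  move=> [p _ pE].
  have /omegaE[k [c _ pc]] : ev omega (pideal p).
    by rewrite -pE; apply/ev_principal/mem_rideal.
  have : ev omega (pideal (w k.+1)).
    by apply/omegaE; exists k.+1; exact: mem_rideal.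
  rewrite -pE => /ev_principal[d _ wp].
  have [b wkE [b1 _]] := fP (k, w k); apply: b1.
  apply: (unit1 _ (d * c)); apply: (iota_mulI iotaM iota_inj (p := w k)).
  by rewrite mulg1 !mulgA -[X in X * d * c]wkE /= in wp *; rewrite wp pc.
apply/seteqP; split=> [g [p [q [-> oq /(shiftedP iotaM iota_inj lcmP) h]]]|_ ->].
  apply: contrapT => pq1.
  have npq : p <> q by move=> pq; apply: pq1; rewrite /= pq mulgV.
  have [k ek] := e_surj (p, q).
  have [c _ [_]] := fP (k, w k); rewrite /= ek => /(_ npq)[|[y qyw]].
    apply: (omega_meet _ _ _ oq); apply/omegaE; exists k.+1; exact: mem_rideal.
  have oqy : ev omega (pideal (q * y)) by apply/omegaE; exists k.+1.
  apply: (omega_meet _ _ _ oqy); apply/h; exists y => //; exact: mem_rideal.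
exists 1, 1; split; [by rewrite mulgV | exact: ev_one |].
apply/(shiftedP iotaM iota_inj lcmP) => x; split=> [ox|[y]]; rewrite ?mul1g.
  have /omegaE[k xw] := ox; exists (w k); rewrite ?mul1g //.
  by apply/omegaE; exists k; exact: mem_rideal.
by move=> /rideal_mulP/ev_mono; apply.
Qed.

(** * The two closure statements and the free character *)

(** The exceptional set consists of the classes of the prefixes of one word that
    represents q. *)
Lemma overlap_free_blocks (A : choiceType) (R : set (seq A * seq A)) (z : seq A) :
  overlap_free R z -> forall q : pres_monoid R,
  exists F : seq (pres_monoid R), forall s y : pres_monoid R,
    rideal q (s * word_class R z * y) -> rideal q s \/ s \in F.
Proof.
move=> zI q; set Q := word_repr q.
exists [seq word_class R (take i Q) | i <- iota 0 (size Q).+1] => s y [t _].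
rewrite -(word_reprK q) -(word_reprK s) -(word_reprK y) -(word_reprK t).
rewrite -!word_class_cat -catA => /word_classP/word_cong_sym.
move=> /(overlap_free_cong zI)[s' [y' [E /word_classP -> _]]].
case: (cat_eq_cat E) => [[m [-> _]]|[m [Em _]]].
  by left; exists (word_class R m); rewrite // word_class_cat.
right; apply/mapP; exists (size s').
  by rewrite mem_iota /= /Q Em size_cat; lia.
by rewrite /Q Em take_size_cat.
Qed.

Theorem theorem3p1 (Sigma : countType) (R : set (seq Sigma * seq Sigma))
    (R_nonempty : forall u v : seq Sigma, R (u, v) -> u <> [::] /\ v <> [::])
    (R_irredundant : forall (s : Sigma) (w : seq Sigma), s \notin w ->
       word_class R [:: s] <> word_class R w)
    (R_proper : forall u : seq Sigma, ~ R (u, u))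
    (P_lcm : right_lcm (pres_monoid R))
    (P_embeds : injective (to_group R))
    (Sigma_ge2 : exists s t : Sigma, s <> t)
    (z_exists : exists z : seq Sigma,
       [/\ z <> [::],
           forall u, relator R u -> ~~ infix z u,
           forall u, relator R u -> ~~ infix u z,
           forall u v, relator R u -> v <> [::] -> prefix v z -> ~~ suffix v u
         & forall u v, relator R u -> v <> [::] -> suffix v z -> ~~ prefix v u]) :
  [/\ (exists (n : nat) (a : 'I_n -> pres_monoid R),
         ~` [set 1] = \bigcup_(i in [set: 'I_n]) rideal (a i)) ->
      forall chi : Omega (pres_monoid R), Omega_infty (pres_monoid R) chi ->
        closure (act_orbit (to_group R) chi) = Omega_infty (pres_monoid R),
      ~ (exists (n : nat) (a : 'I_n -> pres_monoid R),
           ~` [set 1] = \bigcup_(i in [set: 'I_n]) rideal (a i)) ->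
      forall chi : Omega (pres_monoid R), Omega_infty (pres_monoid R) chi ->
        closure (act_orbit (to_group R) chi) = [set: Omega (pres_monoid R)]
    & exists2 omega : Omega (pres_monoid R), Omega_infty (pres_monoid R) omega &
        act_stabilizer (to_group R) omega = [set 1]].
Proof.
have iotaM : {morph to_group R : x y / x * y} := (to_group_monoid_morphism R).2.
have [z [zn z1 z2 z3 z4]] := z_exists.
have zI : overlap_free R z by split.
have Rne w : relator R w -> w <> [::].
  by move=> [v [/R_nonempty[]|/R_nonempty[]]].
have unit1 (x y : pres_monoid R) : x * y = 1 -> x = 1.
  rewrite -(word_reprK x) -(word_reprK y) -word_class_cat => /word_classP.
  move=> /word_cong_sym/(word_cong_nil Rne)/(_ erefl).
  by case: (word_repr x).
have infty_closure chi psi : Omega_infty (pres_monoid R) psi ->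
    closure (act_orbit (to_group R) chi) psi.
  move=> psioo.
  refine (mem_closure_orbit iotaM P_embeds P_lcm _ (overlap_free_blocks zI) _).
  by move=> p Q F; exact: infty_room.
split=> [cof chi chioo|ncof chi chioo|].
- apply/seteqP; split=> psi; last exact: infty_closure.
  move=> /(closureS (orbit_infty iotaM P_embeds P_lcm chioo)).
  exact: (nonidentity_fg_infty_closed iotaM P_embeds P_lcm unit1 cof).
- apply/seteqP; split=> // psi _.
  case: (pselect (Omega_infty (pres_monoid R) psi)) => [/infty_closure//|].
  move=> /contrapT[p _ <-].
  refine (mem_closure_orbit iotaM P_embeds P_lcm _ (overlap_free_blocks zI) _).
  move=> p' Q F; exact: (principal_room iotaM P_embeds P_lcm unit1 F ncof).
have [s [t st]] := Sigma_ge2.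
pose e k := if @unpickle (seq Sigma * seq Sigma)%type k is Some (u, v)
  then (word_class R u, word_class R v) else (1, 1).
apply: (@trivial_stabilizer _ _ _ e (word_class R [:: s])) => //.
- move=> /word_classP/word_cong_sym/(word_cong_nil Rne)/(_ erefl); by [].
- move=> [p q]; exists (pickle (word_repr p, word_repr q)).
  by rewrite /e pickleK !word_reprK.
- move=> p q pq.
  have [x xP] :=
    @separating_word _ R z s t (word_repr p) (word_repr q) Rne zI zn st.
  exists (word_class R x) => y y' E; apply: pq.
  rewrite -(word_reprK p) -(word_reprK q); apply/word_classP.
  apply: (xP (word_repr y) (word_repr y')); apply/word_classP.
  by rewrite !word_class_cat !word_reprK !mulgA.
Qed.
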